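(* Let $\mathsf\Omega=\mathsf\Omega_{\mathrm{lab}}$ be the category of finite non-empty sets and all maps, let $\mathsf U$ be the category of finite sets and injective maps, and let $\Theta_{\mathsf{Meas}}:\mathsf\Omega^{\mathrm{op}}\to\mathsf{Meas}$ be an arbitrary parameter functor. Let $\Lambda:\mathsf\Omega^{\mathrm{op}}\to\mathsf{Meas}$ be a target. A sample-indexed quantity $G$ with target $\Lambda$ is Tjur-meaningful if and only if $G_{(u,\omega,x)}=g_\omega$ depends only on the support $\omega$ of the sample and the design-indexed quantity $g=(g_\omega)_\omega$ is Tjur-natural. In this case $g_\omega=G_{(\omega,\omega,\mathrm{id}_\omega)}$. Every meaningful design-indexed quantity is Tjur-natural, and the converse does not hold in general (i.e. there exist a parameter functor, a target and a Tjur-natural design-indexed quantity which is not meaningful).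
   Context: $\mathsf{Meas}$ is the category of measurable spaces and measurable maps. $\mathsf{Stoch}$ has the measurable spaces as objects and the Markov kernels $k:X\rightsquigarrow Y$ as morphisms, with composition $(k'\circ k)(x)(C)=\int_Y k'(y)(C)\,k(x)(\mathrm dy)$. $\delta:\mathsf{Meas}\to\mathsf{Stoch}$ is the identity on objects and sends $f$ to the kernel $x\mapsto\delta_{f(x)}$. A design is a triple $d=(u,\omega,x)$ with $u$ an object of $\mathsf U$, $\omega$ an object of $\mathsf\Omega$ and $x:u\to\omega$ a map; a morphism of designs $(u',\omega',x')\to(u,\omega,x)$ is a pair $(\varphi:u'\to u\text{ in }\mathsf U,\ \psi:\omega'\to\omega\text{ in }\mathsf\Omega)$ with $x\circ\varphi=\psi\circ x'$. A design-indexed quantity with target $\Lambda$ is a family of morphisms $g_\omega:\Theta_{\mathsf{Meas}}(\omega)\rightsquigarrow\Lambda(\omega)$ of $\mathsf{Stoch}$, $\omega\in\mathrm{ob}\,\mathsf\Omega$. It is coherent over a subcategory $\mathsf Q\subseteq\mathsf\Omega$ containing all objects if $g_\omega\circ\delta\Theta_{\mathsf{Meas}}(\psi)=\delta\Lambda(\psi)\circ g_{\omega'}$ for every $\psi:\omega\to\omega'$ in $\mathsf Q$. It is meaningful if it is coherent over $\mathsf\Omega$, and Tjur-natural if it is coherent over $\mathsf\Omega_{\mathrm{red}}$, the subcategory generated by the insertions, i.e. the proper inclusions $\omega'\subsetneq\omega$ between objects of $\mathsf\Omega$. A sample-indexed quantity with target $\Lambda$ is a family of morphisms $G_d:\Theta_{\mathsf{Meas}}(\omega)\rightsquigarrow\Lambda(\omega)$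 of $\mathsf{Stoch}$ indexed by the designs $d=(u,\omega,x)$ with $x$ surjective; $\omega$ is the support of the sample $(u,x)$. A Tjur reduction of a design $d=(u,\omega,x)$ with $x$ surjective is a morphism of designs $(\varphi,\psi):d'=(u',\omega',x')\to d$ where $\varphi:u'\hookrightarrow u$ is the inclusion of a proper subsample (an injective, non-surjective map of $\mathsf U$), $\omega'=x(\varphi(u'))$, $x'$ is the corestriction of $x\circ\varphi$, and $\psi:\omega'\hookrightarrow\omega$ is the inclusion. $G$ is Tjur-meaningful if $G_{d'}\circ\delta\Theta_{\mathsf{Meas}}(\psi)=\delta\Lambda(\psi)\circ G_d$ for every Tjur reduction $(\varphi,\psi):d'\to d$. *)

(* Defs.v *)
From HB Require Import structures.
From mathcomp Require Import all_boot all_order all_algebra finmap.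
From mathcomp Require Import all_classical all_reals all_analysis.
From mathcomp Require Import measurable_realfun.

Set Implicit Arguments.
Unset Strict Implicit.
Unset Printing Implicit Defensive.
Import Order.TTheory GRing.Theory Num.Theory.
Local Open Scope classical_set_scope.

(* The library's [measurableType] is pointed, which excludes the empty         *)
(* measurable space.  [meas] is the class of all measurable spaces, and        *)
(* [at_point Y y] turns a space [Y] with a point [y] into a [measurableType],  *)
(* so that the library's measures and integral can be used; nothing below      *)
(* depends on which point is taken.                                            *)
Record meas := Meas {
  carrier :> Type;
  event : set (set carrier);
  event_sigma_algebra : sigma_algebra [set: carrier] event }.

Definition measurable_map (X Y : meas) (f : X -> Y) : Prop :=
  forall B, event B -> event (f @^-1` B).

Record meas_hom (X Y : meas) := MeasHom {
  meas_fun :> X -> Y;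
  meas_funP : measurable_map meas_fun }.

Definition at_point (Y : meas) (y : Y) : Type := Y.

Section at_point_instances.
Variables (Y : meas) (y : Y).
HB.instance Definition _ := gen_eqMixin (at_point y).
HB.instance Definition _ := gen_choiceMixin (at_point y).
HB.instance Definition _ := isPointed.Build (at_point y) y.

Let event0 : event (set0 : set Y).
Proof. by case: (event_sigma_algebra Y). Qed.

Let eventC (A : set Y) : event A -> event (~` A).
Proof. by case: (event_sigma_algebra Y) => _ + _ => /[apply]; rewrite setTD. Qed.

Let event_bigcup (F : (set Y)^nat) :
  (forall i, event (F i)) -> event (\bigcup_i F i).
Proof. by case: (event_sigma_algebra Y) => _ _; apply. Qed.

HB.instance Definition _ := @isMeasurable.Build default_measure_display
  (at_point y) (@event Y) event0 eventC event_bigcup.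
End at_point_instances.

Definition is_probability (R : realType) (Y : meas) (mu : set Y -> \bar R) :
    Prop :=
  exists (y : Y) (P : probability (at_point y) R), forall A, mu A = P A.

Definition meas_integral (R : realType) (Y : meas) (mu : set Y -> \bar R)
    (h : Y -> \bar R) : \bar R :=
  match pselect (exists y : Y, True) with
  | left ex => (\int[mu : set (at_point (projT1 (cid ex))) -> \bar R]_y h y)%E
  | right _ => 0%E
  end.

Record markov_kernel (R : realType) (X Y : meas) := MarkovKernel {
  kernel_fun :> X -> set Y -> \bar R;
  kernel_probability : forall x, is_probability (kernel_fun x);
  kernel_measurable : forall C, event C -> forall x0 : X,
    measurable_fun [set: at_point x0] (kernel_fun ^~ C : at_point x0 -> \bar R) }.

Definition stoch_comp (R : realType) (X Y Z : meas)
    (k' : markov_kernel R Y Z) (k : markov_kernel R X Y) :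
    X -> set Z -> \bar R :=
  fun x C => meas_integral (k x) (fun y => k' y C).

(* Library measures are functions on all sets; as morphisms of Stoch, two      *)
(* kernels are equal when they agree on the sigma-algebra.                     *)
Definition kernel_eq (R : realType) (X Y : meas) (k k' : X -> set Y -> \bar R) :
    Prop :=
  forall x C, event C -> k x C = k' x C.

Section delta.
Variables (R : realType) (X Y : meas) (f : meas_hom X Y).

Definition delta_fun (x : X) : set Y -> \bar R :=
  @dirac _ (at_point (f x)) (f x) R.

Let delta_probability x : is_probability (delta_fun x).
Proof. by exists (f x), (@dirac _ (at_point (f x)) (f x) R). Qed.

Let delta_measurable (C : set Y) : event C -> forall x0 : X,
  measurable_fun [set: at_point x0] (delta_fun ^~ C : at_point x0 -> \bar R).
Proof.
move=> eC x0.
have mD : measurable (f @^-1` C : set (at_point x0)) by exact: meas_funP.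
rewrite (_ : delta_fun ^~ C = fun z : at_point x0 =>
    (\1_(f @^-1` C : set (at_point x0)) z)%:E).
  by apply/measurable_EFinP; exact: measurable_indic.
by apply/funext => z.
Qed.

Definition delta : markov_kernel R X Y :=
  MarkovKernel delta_probability delta_measurable.
End delta.

(* Finite sets are the finite subsets [{fset K}] of a universe of labels [K],  *)
(* so that inclusions and proper inclusions between objects make sense.        *)
(* Maps are plain functions between the associated finite types.               *)
Record label_set (K : choiceType) := LabelSet {
  labels :> {fset K};
  labels_neq0 : labels != fset0 }.

Record label_functor (K : choiceType) := LabelFunctor {
  fob :> label_set K -> meas;
  fhom : forall a b : label_set K, (a -> b) -> meas_hom (fob b) (fob a);
  fhom_id : forall a : label_set K, @fhom a a idfun =1 id;
  fhom_comp : forall (a b c : label_set K) (psi : a -> b) (psi' : b -> c),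
    fhom (psi' \o psi) =1 fhom psi \o fhom psi' }.

Record wide_subcategory (K : choiceType) := WideSubcategory {
  in_subcategory :> forall a b : label_set K, (a -> b) -> Prop;
  in_subcategory_id : forall a : label_set K, @in_subcategory a a idfun;
  in_subcategory_comp : forall (a b c : label_set K) (psi : a -> b) (psi' : b -> c),
    in_subcategory psi -> in_subcategory psi' ->
    in_subcategory (psi' \o psi) }.

Definition full_category (K : choiceType) : wide_subcategory K :=
  @WideSubcategory K (fun _ _ _ => True)
    (fun _ => I) (fun _ _ _ _ _ _ _ => I).

Inductive generated_by_insertions (K : choiceType) :
    forall a b : label_set K, (a -> b) -> Prop :=
| gen_insertion (a b : label_set K) (ab : (a `<=` b)%fset) :
    (a `<` b)%fset -> generated_by_insertions (fincl ab)
| gen_id (a : label_set K) : @generated_by_insertions K a a idfun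
| gen_comp (a b c : label_set K) (psi : a -> b) (psi' : b -> c) :
    generated_by_insertions psi -> generated_by_insertions psi' ->
    generated_by_insertions (psi' \o psi).

Definition reduction_category (K : choiceType) : wide_subcategory K :=
  WideSubcategory (@gen_id K) (@gen_comp K).

Definition design_quantity (R : realType) (K : choiceType)
    (Theta Lambda : label_functor K) : Type :=
  forall w : label_set K, markov_kernel R (Theta w) (Lambda w).

Definition coherent_over (R : realType) (K : choiceType)
    (Theta Lambda : label_functor K) (Q : wide_subcategory K)
    (g : design_quantity R Theta Lambda) : Prop :=
  forall (w w' : label_set K) (psi : w -> w'), Q w w' psi ->
    kernel_eq (stoch_comp (g w) (delta R (fhom Theta psi)))
              (stoch_comp (delta R (fhom Lambda psi)) (g w')).

Definition meaningful (R : realType) (K : choiceType)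
    (Theta Lambda : label_functor K) (g : design_quantity R Theta Lambda) :=
  coherent_over (full_category K) g.

Definition tjur_natural (R : realType) (K : choiceType)
    (Theta Lambda : label_functor K) (g : design_quantity R Theta Lambda) :=
  coherent_over (reduction_category K) g.

Definition surjective_map (A B : Type) (f : A -> B) : Prop :=
  forall b, exists a, f a = b.

Record design (K : choiceType) := Design {
  design_units : {fset K};
  design_support : label_set K;
  labelling : design_units -> design_support }.

Record design_hom (K : choiceType) (d' d : design K) := DesignHom {
  unit_map : design_units d' -> design_units d;
  unit_map_inj : injective unit_map;
  label_map : design_support d' -> design_support d;
  design_hom_square :
    labelling (d := d) \o unit_map =1 label_map \o labelling (d := d') }.

Record sample (K : choiceType) := Sample {
  sample_design :> design K;
  labelling_surj : surjective_map (labelling (d := sample_design)) }.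

Definition id_sample (K : choiceType) (w : label_set K) : sample K :=
  @Sample K (@Design K w w idfun) (fun b => ex_intro _ b erefl).

(* The last two conjuncts say that the support of [d'] is the image of the     *)
(* subsample and that [label_map m] is the inclusion; with                     *)
(* [design_hom_square], this forces the labelling of [d'] to be the            *)
(* corestriction.                                                              *)
Definition tjur_reduction (K : choiceType) (d' d : design K)
    (m : design_hom d' d) : Prop :=
  [/\ ~ surjective_map (unit_map m),
      (forall k : K, k \in (design_support d' : {fset K}) <->
         exists i : design_units d', val (labelling (unit_map m i)) = k) &
      (forall t : design_support d', val (label_map m t) = val t)].

Definition sample_quantity (R : realType) (K : choiceType)
    (Theta Lambda : label_functor K) : Type :=
  forall d : sample K,
    markov_kernel R (Theta (design_support d)) (Lambda (design_support d)).

Definition tjur_meaningful (R : realType) (K : choiceType)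
    (Theta Lambda : label_functor K) (G : sample_quantity R Theta Lambda) :
    Prop :=
  forall (d' d : sample K) (m : design_hom d' d), tjur_reduction m ->
    kernel_eq (stoch_comp (G d') (delta R (fhom Theta (label_map m))))
              (stoch_comp (delta R (fhom Lambda (label_map m))) (G d)).

Definition depends_only_on_support (R : realType) (K : choiceType)
    (Theta Lambda : label_functor K) (G : sample_quantity R Theta Lambda)
    (g : design_quantity R Theta Lambda) : Prop :=
  forall d : sample K, kernel_eq (G d) (g (design_support d)).

(* Main.v *)
Require Import Defs.
From HB Require Import structures.
From mathcomp Require Import all_boot all_order all_algebra finmap.
From mathcomp Require Import all_classical all_reals all_analysis.
From mathcomp Require Import measurable_realfun.

Local Open Scope classical_set_scope.

(** Composing a kernel with a deterministic kernel on either side needs no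
integral: it substitutes in the argument, or takes a preimage in the event.
Coherence of quantities is thus a family of pointwise equations, which hold for
identities and pass to composites by functoriality, so Tjur-naturality only has
to be checked on the insertions.

The heart of the matter is that a Tjur-meaningful [G] cannot see more of a
sample than its support [w].  Reductions only delete units, but two samples
with surjective labellings [x : u -> w] and [z : v -> w] are both obtained by
deleting units from a single one, their disjoint union, labelled by [x] on [u]
and by [z] on [v].  Both reductions keep the whole support, so they lie over
the identity of [w] and give [G_x = G_(x+z) = G_z] ([eq_quantity_support]).
Being non-empty, [w] forces [u] and [v] to be non-empty, hence both subsamples
to be proper; the infinitude of the universe of labels provides room for the
disjoint union.  Comparing with the identity sample yields
[G_(u,w,x) = G_(w,w,id)].  The family [w |-> G_(w,w,id)] is Tjur-natural because an
insertion of supports is itself a reduction between identity samples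
([id_sample_tjur_natural]).  Conversely, a reduction lies over an inclusion of
supports, which is an insertion or an identity, so a Tjur-natural family
restricts along every reduction ([support_tjur_meaningful]).

For the last claim, a quantity may use the names of the labels: fixing a
predicate on labels and restricting it to each support is compatible with
inclusions, but not with a map that changes the truth value
([restriction_quantityE]). *)

(** * Composition with deterministic kernels *)

Section composition_with_delta.
Context {R : realType}.

Lemma stoch_comp_deltar (X Y Z : meas) (f : meas_hom X Y)
    (k : markov_kernel R Y Z) (x : X) (C : set Z) :
  event C -> stoch_comp k (delta R f) x C = k (f x) C.
Proof.
move=> eC; rewrite /stoch_comp /meas_integral.
case: pselect => [ex|[]]; last by exists (f x).
set y0 := projT1 _.
have mk := @kernel_measurable _ _ _ k C eC y0.
have := integral_dirac (f x : at_point y0) measurableT mk.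
by rewrite diracT mul1e.
Qed.

(** A probability comes with the point of its space that was used to regard it
as a measure, whereas [meas_integral] picks a point of its own: the measure
axioms have to be carried from one to the other. *)
Lemma is_probability_at_point {Y : meas} {mu : set Y -> \bar R} (y0 : Y) :
  is_probability mu ->
  exists P : {measure set (at_point y0) -> \bar R}%R, mu = P.
Proof.
move=> [y [P muP]].
pose m := isMeasure.Build default_measure_display (at_point y0) R
  (P : set (at_point y0) -> \bar R)
  (measure0 P) (measure_ge0 P) (@measure_semi_sigma_additive _ _ _ P).
pose Q : {measure set (at_point y0) -> \bar R}%R :=
  HB.pack (P : set (at_point y0) -> \bar R) m.
by exists Q; apply/funext => A; exact: muP.
Qed.

Lemma stoch_comp_deltal (X Y Z : meas) (f : meas_hom Y Z)
    (k : markov_kernel R X Y) (x : X) (C : set Z) :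
  event C -> stoch_comp (delta R f) k x C = k x (f @^-1` C).
Proof.
move=> eC; rewrite /stoch_comp /meas_integral.
have kx := kernel_probability k x.
case: pselect => [ex|[]]; last by case: kx => y _; exists y.
set y0 := projT1 _.
have [P ->] := is_probability_at_point y0 kx.
have mfC : measurable (f @^-1` C : set (at_point y0)) by exact: meas_funP.
have := integral_indic P measurableT mfC.
by rewrite setIT.
Qed.

End composition_with_delta.

(** * Pointwise form of coherence *)

Section coherence.
Context {R : realType} {K : choiceType} {Theta Lambda : label_functor K}.

Lemma square_eqP {a b : label_set K} (psi : a -> b)
    (k : markov_kernel R (Theta a) (Lambda a))
    (k' : markov_kernel R (Theta b) (Lambda b)) :
  kernel_eq (stoch_comp k (delta R (fhom Theta psi)))
            (stoch_comp (delta R (fhom Lambda psi)) k') <->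
  forall (x : Theta b) (C : set (Lambda a)), event C ->
    k (fhom Theta psi x) C = k' x (fhom Lambda psi @^-1` C).
Proof.
by split=> H x C eC; have := H x C eC;
  rewrite stoch_comp_deltar// stoch_comp_deltal.
Qed.

(** Coherence squares paste along composition, so the generators suffice. *)
Lemma tjur_natural_insertions (g : design_quantity R Theta Lambda) :
  (forall (a b : label_set K) (ab : (a `<=` b)%fset), (a `<` b)%fset ->
     kernel_eq (stoch_comp (g a) (delta R (fhom Theta (fincl ab))))
               (stoch_comp (delta R (fhom Lambda (fincl ab))) (g b))) ->
  tjur_natural g.
Proof.
move=> gins w w' psi; elim=> {w w' psi} [a b ab pab|a|a b c psi psi' _ IH _ IH'].
- exact: gins.
- apply/square_eqP => x C eC; rewrite fhom_id.
  by congr (g a x _); apply/funext => y; rewrite /preimage /= fhom_id.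
- move/square_eqP: IH => IH; move/square_eqP: IH' => IH'.
  apply/square_eqP => x C eC.
  rewrite fhom_comp /= IH// IH'; last exact: meas_funP.
  by congr (g c x _); apply/funext => y; rewrite /preimage /= fhom_comp.
Qed.

End coherence.

(** * Inclusions of supports *)

Lemma label_set_inj (K : choiceType) : injective (@labels K).
Proof.
by move=> [a a0] [b b0] /= ab; case: _ / ab b0 => b0; rewrite (bool_irrelevance a0 b0).
Qed.

(** Insertions are proper, so an inclusion between equal supports enters the
generated subcategory as an identity. *)
Lemma inclusion_in_reduction_category (K : choiceType) (a b : label_set K)
    (psi : a -> b) :
  (forall t, val (psi t) = val t) -> reduction_category K a b psi.
Proof.
move=> psiE.
have ab : (a `<=` b)%fset.
  by apply/fsubsetP => k ka; rewrite -[k]/(val [` ka]%fset) -psiE; exact: valP.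
have [pab|] := boolP (a `<` b)%fset.
  suff -> : psi = fincl ab by exact: gen_insertion.
  by apply/funext => t; apply/val_inj; rewrite psiE.
rewrite fproperEneq ab andbT negbK => /eqP/label_set_inj eab.
case: _ / eab psi psiE {ab} => psi psiE.
suff -> : psi = idfun by exact: gen_id.
by apply/funext => t; apply/val_inj; rewrite psiE.
Qed.

(** * Disjoint unions of samples *)

Lemma finType_embeds_in_fset {K : choiceType} (T : finType) :
  infinite_set [set: K] ->
  exists (B : {fset K}) (j : T -> B), injective j.
Proof.
move=> Kinf; have [B _ cB] := infinite_set_fset #|T| Kinf.
rewrite cardfE in cB; exists B.
exists (fun t => enum_val (widen_ord cB (enum_rank t))) => s t.
by move/enum_val_inj => /(congr1 val) /= /val_inj /enum_rank_inj.
Qed.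

(** The set of labels receiving a disjoint union may be larger than it; the
remaining labels get the default value [c]. *)
Lemma injective_extension {A B C : Type} (j : A -> B) (f : A -> C) (c : C) :
  injective j -> exists h : B -> C, h \o j =1 f.
Proof.
move=> jinj.
exists (fun b => if pselect (exists a, j a = b) is left ab
                 then f (projT1 (cid ab)) else c) => a /=.
case: pselect => [ab|[]]; last by exists a.
by congr f; apply/jinj; case: cid.
Qed.

Definition surjective_sample {K : choiceType} {u : {fset K}} {w : label_set K}
    {x : u -> w} (xs : surjective_map x) : sample K :=
  @Sample K (Design x) xs.

(** * Quantities seen through their support *)

Section support.
Context {R : realType} {K : choiceType} {Theta Lambda : label_functor K}.
Context {G : sample_quantity R Theta Lambda}.
Context (Gmeaningful : tjur_meaningful G).

(** Deleting units without losing any label is a reduction over the identity of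
the support, and functors send the identity to the identity. *)
Lemma eq_quantity_subsample {u u' : {fset K}} {w : label_set K}
    {x : u -> w} {x' : u' -> w} (xs : surjective_map x)
    (xs' : surjective_map x') (phi : u' -> u) :
  injective phi -> ~ surjective_map phi -> x \o phi =1 x' ->
  kernel_eq (G (surjective_sample xs')) (G (surjective_sample xs)).
Proof.
move=> phi_inj phi_ns xphi t C eC.
have sq : x \o phi =1 idfun \o x' by [].
pose m := @DesignHom K (Design x') (Design x) phi phi_inj idfun sq.
have red : tjur_reduction m.
  split=> // k; split=> [kw|[i <-]]; last exact: valP.
  by have [i xi] := xs' [` kw]%fset; exists i; rewrite [labelling _]xphi xi.
have /square_eqP/(_ t C eC) /= :=
  Gmeaningful (surjective_sample xs') (surjective_sample xs) m red.
rewrite fhom_id => ->; apply: (congr1 (G (surjective_sample xs) t)).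
by apply/funext => y; rewrite /preimage /= fhom_id.
Qed.

(** Both samples are proper subsamples of one that contains their disjoint
union, so [G] agrees with its value there on each of them. *)
Lemma eq_quantity_support {u v : {fset K}} {w : label_set K}
    {x : u -> w} {z : v -> w} (xs : surjective_map x) (zs : surjective_map z) :
  infinite_set [set: K] ->
  kernel_eq (G (surjective_sample xs)) (G (surjective_sample zs)).
Proof.
move=> K_infinite.
(* A unit in each sample makes the complement of the other one non-empty. *)
have [k kw] := fset0Pn _ (labels_neq0 w); pose l : w := [` kw]%fset.
have [i _] := xs l; have [i' _] := zs l.
have [B [j jinj]] := finType_embeds_in_fset (u + v)%type K_infinite.
have [h hj] :=
  injective_extension j (fun s => match s with inl a => x a | inr b => z b end)
    l jinj.
have hs : surjective_map h.
  by move=> c; have [a <-] := xs c; exists (j (inl a)); exact: hj.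
have eqx : kernel_eq (G (surjective_sample xs)) (G (surjective_sample hs)).
  apply: (eq_quantity_subsample hs xs (j \o inl)).
  - by move=> a b /jinj[].
  - by move=> /(_ (j (inr i')))[a /jinj].
  - by move=> a; exact: hj.
have eqz : kernel_eq (G (surjective_sample zs)) (G (surjective_sample hs)).
  apply: (eq_quantity_subsample hs zs (j \o inr)).
  - by move=> a b /jinj[].
  - by move=> /(_ (j (inl i)))[a /jinj].
  - by move=> a; exact: hj.
by move=> t C eC; rewrite eqx// eqz.
Qed.

Lemma id_sample_tjur_natural : tjur_natural (fun w => G (id_sample w)).
Proof.
apply: tjur_natural_insertions => a b ab pab.
have inj : injective (fincl ab).
  by move=> s t /(congr1 val) st; exact/val_inj.
pose m := @DesignHom K (id_sample a) (id_sample b) (fincl ab) inj (fincl ab)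
  (fun _ => erefl).
apply: (Gmeaningful (id_sample a) (id_sample b) m); split=> //.
- move=> surj; move: pab; rewrite fproperE ab => /fsubsetPn[k kb /negP]; apply.
  by have [t /(congr1 val) /= <-] := surj [` kb]%fset; exact: valP.
- move=> k; split=> [ka|[t <-]]; last exact: (valP t).
  by exists [` ka]%fset.
Qed.

End support.

Lemma support_tjur_meaningful {R : realType} {K : choiceType}
    {Theta Lambda : label_functor K} {G : sample_quantity R Theta Lambda}
    {g : design_quantity R Theta Lambda} :
  depends_only_on_support G g -> tjur_natural g -> tjur_meaningful G.
Proof.
move=> Gg gnat d' d m [_ _ mE].
have /square_eqP gm := gnat _ _ _ (inclusion_in_reduction_category _ _ _ _ mE).
apply/square_eqP => x C eC.
by rewrite Gg// gm// Gg//; exact: meas_funP.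
Qed.

(** * A Tjur-natural quantity that is not meaningful *)

Section counterexample.
Context {K : choiceType}.

Lemma discrete_sigma_algebra (T : Type) :
  sigma_algebra [set: T] [set: set T].
Proof. by []. Qed.

Definition discrete (T : Type) : meas := Meas (discrete_sigma_algebra T).

Definition point_functor : label_functor K :=
  @LabelFunctor K (fun _ => discrete unit)
    (fun _ _ _ => @MeasHom (discrete unit) (discrete unit) idfun (fun _ eB => eB))
    (fun _ _ => erefl) (fun _ _ _ _ _ _ => erefl).

Definition predicate_functor : label_functor K :=
  @LabelFunctor K (fun w => discrete (w -> Prop))
    (fun a b psi =>
       @MeasHom (discrete (b -> Prop)) (discrete (a -> Prop))
         (fun p => p \o psi) (fun _ _ => I))
    (fun _ _ => erefl) (fun _ _ _ _ _ _ => erefl).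

Definition restriction_quantity (R : realType) (P : K -> Prop) :
    design_quantity R point_functor predicate_functor :=
  fun w => delta R
    (@MeasHom (discrete unit) (discrete (w -> Prop)) (fun _ => P \o val)
       (fun _ _ => I)).

(** Distinct Dirac masses on a discrete space are told apart by a singleton, so
coherence of this quantity is an equality of predicates on labels. *)
Lemma restriction_quantityE (R : realType) (P : K -> Prop) (a b : label_set K)
    (psi : a -> b) :
  kernel_eq
    (stoch_comp (restriction_quantity R P a) (delta R (fhom point_functor psi)))
    (stoch_comp (delta R (fhom predicate_functor psi))
       (restriction_quantity R P b)) <->
  forall t, P (val t) = P (val (psi t)).
Proof.
rewrite square_eqP; split=> [H t|H x C _].
  have /= := H tt [set P \o val] I.
  rewrite /delta_fun !diracE.
  rewrite mem_set//.
  case: (boolP (_ \in _)); last by move=> _ [] /eqP; rewrite GRing.oner_eq0.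
  by rewrite inE /= => /(congr1 (@^~ t)) /= ->.
rewrite /= /delta_fun !diracE.
suff -> : (P \o val : a -> Prop) = (P \o val) \o psi by [].
by apply/funext => t; exact: H.
Qed.

End counterexample.

(** The property of being the label [i] is lost under the relabelling
[i |-> j]. *)
Lemma tjur_natural_not_meaningful (R : realType) {K : choiceType} (i j : K) :
  i != j ->
  exists (Theta Lambda : label_functor K) (g : design_quantity R Theta Lambda),
    tjur_natural g /\ ~ meaningful g.
Proof.
move=> ij.
exists point_functor, predicate_functor, (restriction_quantity R (eq i)); split.
  by apply: tjur_natural_insertions => a b ab _; exact/restriction_quantityE.
move=> gm.
have ne (k : K) : [fset k]%fset != fset0 by apply/fset0Pn; exists k; rewrite inE.
pose a := LabelSet (ne i); pose b := LabelSet (ne j).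
pose psi (t : a) : b := [` fset11 j]%fset.
have /restriction_quantityE/(_ [` fset11 i]%fset) /= := gm a b psi I.
by move=> ii; move/eqP: ij; apply; rewrite -ii.
Qed.

Theorem theorem1p3 (R : realType) (K : choiceType)
    (K_infinite : infinite_set [set: K]) :
  (forall Theta Lambda : label_functor K,
     (forall G : sample_quantity R Theta Lambda,
        (tjur_meaningful G <->
         exists g : design_quantity R Theta Lambda,
           depends_only_on_support G g /\ tjur_natural g) /\
        (forall g : design_quantity R Theta Lambda,
           depends_only_on_support G g -> tjur_natural g ->
           forall w : label_set K, kernel_eq (g w) (G (id_sample w)))) /\
     (forall g : design_quantity R Theta Lambda,
        meaningful g -> tjur_natural g)) /\
  (exists (Theta Lambda : label_functor K) (g : design_quantity R Theta Lambda),
     tjur_natural g /\ ~ meaningful g).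
Proof.
split; last first.
- have [B [j jinj]] := finType_embeds_in_fset bool K_infinite.
  apply: (tjur_natural_not_meaningful R (val (j true)) (val (j false))).
  by apply/eqP => /val_inj/jinj.
- move=> Theta Lambda; split=> [G|g gm w w' psi _]; last exact: gm.
  split=> [|g Gg _ w x C eC]; last by rewrite -(Gg (id_sample w)).
  split=> [Gm|[g [Gg gnat]]]; last exact: support_tjur_meaningful Gg gnat.
  exists (fun w => G (id_sample w)); split; last exact: id_sample_tjur_natural.
  case=> -[u w x] xs.
  exact: (eq_quantity_support Gm xs (@labelling_surj _ (id_sample w)) K_infinite).
Qed.
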